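(* Let $n,m\ge1$. The maps $$\Psi_1:(\mathscr{P}_n(\mathbb{C}),d_{\log,\mathbb{C}})\to(\widetilde{\mathscr{P}}_n(\mathbb{C}),\tilde d_{\log,\mathbb{R}}),\qquad \Psi_2:(\mathscr{P}_m(\mathbb{H}),d_{\log,\mathbb{H}})\to(\widetilde{\mathscr{P}}_m(\mathbb{H}),\tilde d_{\log,\mathbb{C}})$$ are isometries. More precisely, for all $A,B\in\mathscr{P}_n(\mathbb{C})$ and $C,D\in\mathscr{P}_m(\mathbb{H})$, $$\tilde d_{\log,\mathbb{R}}(\Psi_1(A),\Psi_1(B))=d_{\log,\mathbb{C}}(A,B),\qquad \tilde d_{\log,\mathbb{C}}(\Psi_2(C),\Psi_2(D))=d_{\log,\mathbb{H}}(C,D).$$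
   Context: For $\mathbb{D}\in\{\mathbb{R},\mathbb{C},\mathbb{H}\}$, $A^*$ is the conjugate transpose of $A\in\mathrm{Mat}_n(\mathbb{D})$, $\mathfrak{p}_n(\mathbb{D})=\{A\in\mathrm{Mat}_n(\mathbb{D}):A=A^*\}$, and $\mathscr{P}_n(\mathbb{D})$ is the set of $A\in\mathfrak{p}_n(\mathbb{D})$ with $x^*Ax>0$ for all nonzero $x\in\mathbb{D}^n$. The exponential series gives a bijection $\exp_{\mathbb{D}}:\mathfrak{p}_n(\mathbb{D})\to\mathscr{P}_n(\mathbb{D})$, with inverse $\log_{\mathbb{D}}$. The Frobenius norm on $\mathrm{Mat}_n(\mathbb{D})$ is $\|X\|_{\mathbb{D}}=\sqrt{\mathrm{tr}(X^*X)}$. The Log-Euclidean distance on $\mathscr{P}_n(\mathbb{D})$ is $d_{\log,\mathbb{D}}(A,B)=\|\log_{\mathbb{D}}(A)-\log_{\mathbb{D}}(B)\|_{\mathbb{D}}$. The maps $\Psi_1:\mathrm{Mat}_n(\mathbb{C})\to\mathrm{Mat}_{2n}(\mathbb{R})$ and $\Psi_2:\mathrm{Mat}_m(\mathbb{H})\to\mathrm{Mat}_{2m}(\mathbb{C})$ are $\Psi_1(A+iB)=\begin{pmatrix}A&B\\-B&A\end{pmatrix}$ ($A,B\in\mathrm{Mat}_n(\mathbb{R})$) and $\Psi_2(Z_1+Z_2j)=\begin{pmatrix}Z_1&Z_2\\-\overline{Z_2}&\overline{Z_1}\end{pmatrix}$ ($Z_1,Z_2\in\mathrm{Mat}_m(\mathbb{C})$,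 using $\mathbb{H}=\mathbb{C}\oplus\mathbb{C}j$). They map $\mathscr{P}_n(\mathbb{C})$ into $\mathscr{P}_{2n}(\mathbb{R})$ and $\mathscr{P}_m(\mathbb{H})$ into $\mathscr{P}_{2m}(\mathbb{C})$. Set $\widetilde{\mathscr{P}}_n(\mathbb{C})=\Psi_1(\mathscr{P}_n(\mathbb{C}))\subset\mathscr{P}_{2n}(\mathbb{R})$ and $\widetilde{\mathscr{P}}_m(\mathbb{H})=\Psi_2(\mathscr{P}_m(\mathbb{H}))\subset\mathscr{P}_{2m}(\mathbb{C})$. Finally, $\tilde d_{\log,\mathbb{R}}$ is $\frac{1}{\sqrt2}$ times the restriction of $d_{\log,\mathbb{R}}$ (on $\mathscr{P}_{2n}(\mathbb{R})$) to $\widetilde{\mathscr{P}}_n(\mathbb{C})$, and $\tilde d_{\log,\mathbb{C}}$ is $\frac{1}{\sqrt2}$ times the restriction of $d_{\log,\mathbb{C}}$ (on $\mathscr{P}_{2m}(\mathbb{C})$) to $\widetilde{\mathscr{P}}_m(\mathbb{H})$. *)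

(* Defs.v *)
From HB Require Import structures.
From mathcomp Require Import all_boot all_order all_algebra.
From mathcomp Require Import complex ring.
From mathcomp Require Import all_classical all_reals all_analysis.

Set Implicit Arguments.
Unset Strict Implicit.
Unset Printing Implicit Defensive.

Import Order.TTheory GRing.Theory Num.Theory.
Import numFieldNormedType.Exports.

Local Open Scope classical_set_scope.
Local Open Scope ring_scope.

(* The quaternion z1 + z2 j, with z1, z2 complex: H = C (+) C j, where
   j ^ 2 = -1 and j z = z^* j; the usual third unit is k = i j. *)
Record quaternion (R : Type) := Quaternion { quat1 : R[i]; quat2 : R[i] }.

Section QuaternionRing.
Variable R : realType.
Local Notation H := (quaternion R).
Implicit Types x y z : H.

Definition pair_of_quat x := (quat1 x, quat2 x).
Definition quat_of_pair (p : R[i] * R[i]) : H := Quaternion p.1 p.2.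
Fact pair_of_quatK : cancel pair_of_quat quat_of_pair.
Proof. by case. Qed.

HB.instance Definition _ := Choice.copy H (can_type pair_of_quatK).

Definition addq x y : H := Quaternion (quat1 x + quat1 y) (quat2 x + quat2 y).
Definition oppq x : H := Quaternion (- quat1 x) (- quat2 x).
Definition mulq x y : H :=
  Quaternion (quat1 x * quat1 y - quat2 x * (quat2 y)^*)
             (quat1 x * quat2 y + quat2 x * (quat1 y)^*).
Definition conjq x : H := Quaternion (quat1 x)^* (- quat2 x).
Definition normsqq x : R[i] :=
  quat1 x * (quat1 x)^* + quat2 x * (quat2 x)^*.
Definition invq x : H :=
  Quaternion ((quat1 x)^* / normsqq x) (- quat2 x / normsqq x).

Fact addqA : associative addq.
Proof. by move=> x y z; rewrite /addq /= !addrA. Qed.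
Fact addqC : commutative addq.
Proof. by move=> x y; congr Quaternion; apply: addrC. Qed.
Fact add0q : left_id (Quaternion 0 0) addq.
Proof. by case=> a b; rewrite /addq /= !add0r. Qed.
Fact addNq : left_inverse (Quaternion 0 0) oppq addq.
Proof. by case=> a b; rewrite /addq /= !addNr. Qed.

HB.instance Definition _ := GRing.isZmodule.Build H addqA addqC add0q addNq.

Fact mulqA : associative mulq.
Proof.
move=> [a b] [c d] [e f]; congr Quaternion;
  by rewrite /= !(rmorphB, rmorphD, rmorphM) /= !conjCK; ring.
Qed.
Fact mul1q : left_id (Quaternion 1 0) mulq.
Proof. by case=> a b; congr Quaternion; rewrite /=; ring. Qed.
Fact mulq1 : right_id (Quaternion 1 0) mulq.
Proof.
by case=> a b; congr Quaternion; rewrite /= ?rmorph0 ?rmorph1; ring.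
Qed.
Fact mulqDl : left_distributive mulq +%R.
Proof. by move=> [a b] [c d] [e f]; congr Quaternion; rewrite /=; ring. Qed.
Fact mulqDr : right_distributive mulq +%R.
Proof.
by move=> [a b] [c d] [e f]; congr Quaternion; rewrite /= rmorphD /=; ring.
Qed.
Fact oneq_neq0 : Quaternion 1 0 != 0 :> H.
Proof. by apply/eqP=> -[] /eqP; rewrite oner_eq0. Qed.

HB.instance Definition _ := GRing.Zmodule_isNzRing.Build H
  mulqA mul1q mulq1 mulqDl mulqDr oneq_neq0.

Fact normsqq_eq0 x : (normsqq x == 0) = (x == 0).
Proof.
rewrite /normsqq -!normCK paddr_eq0 ?exprn_ge0// !sqrf_eq0 !normr_eq0.
by case: x => a b; apply/andP/eqP => /= [[/eqP-> /eqP->]|[-> ->]].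
Qed.

Fact normsqq_conj x : (normsqq x)^* = normsqq x.
Proof. by rewrite /normsqq rmorphD !rmorphM /= !conjCK; ring. Qed.

Fact mulVq : {in predC1 (0 : H), left_inverse 1 invq *%R}.
Proof.
move=> x; rewrite inE /= -normsqq_eq0 => x0.
rewrite -[RHS]/(Quaternion 1 0); congr Quaternion => /=; last by ring.
by rewrite -(divff x0) {3}/normsqq; ring.
Qed.
Fact mulqV : {in predC1 (0 : H), right_inverse 1 invq *%R}.
Proof.
move=> x; rewrite inE /= -normsqq_eq0 => x0.
rewrite -[RHS]/(Quaternion 1 0); congr Quaternion => /=;
  rewrite !rmorphM /= fmorphV /= normsqq_conj ?rmorphN /= ?conjCK; last by ring.
by rewrite -(divff x0) {3}/normsqq; ring.
Qed.
Fact unitqP x y : y * x = 1 /\ x * y = 1 -> x != 0.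
Proof.
by move=> [+ _]; apply: contra_eq_neq => ->; rewrite mulr0 eq_sym oner_eq0.
Qed.
Fact invq_out : {in [predC predC1 (0 : H)], invq =1 id}.
Proof.
move=> x; rewrite !inE negbK => /eqP->.
by congr Quaternion; rewrite /= ?rmorph0 ?oppr0 mul0r.
Qed.

HB.instance Definition _ := GRing.NzRing_hasMulInverse.Build H
  mulVq mulqV unitqP invq_out.

End QuaternionRing.

Inductive scalars := RR | CC | HH.

Definition carrier (R : realType) (D : scalars) : unitRingType :=
  match D with RR => R | CC => R[i] | HH => quaternion R end.

Definition conjD (R : realType) (D : scalars) :
    carrier R D -> carrier R D :=
  match D with
  | RR => id
  | CC => @Num.conj R[i]
  | HH => @conjq R
  end.

Definition reD (R : realType) (D : scalars) : carrier R D -> R :=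
  match D with
  | RR => id
  | CC => @complex.Re R
  | HH => fun q => complex.Re (quat1 q)
  end.

Section LogEuclidean.
Variables (R : realType) (D : scalars).
Local Notation K := (carrier R D).

Definition ctrmx m n (A : 'M[K]_(m, n)) : 'M[K]_(n, m) :=
  map_mx (@conjD R D) A^T.

Definition selfadjoint n : set 'M[K]_n := [set A | A = ctrmx A].

(* As A = A^*, the scalar x^* A x is fixed by the conjugation, i.e. it is real;
   reD only views it as an element of R. The same holds in frobenius. *)
Definition posdef n : set 'M[K]_n :=
  [set A | selfadjoint A /\
    forall x : 'cV[K]_n, x != 0 -> 0 < reD ((ctrmx x *m A *m x) 0 0)].

Definition frobenius n (X : 'M[K]_n) : R :=
  Num.sqrt (reD (\tr (ctrmx X *m X))).

Definition exp_partial n (X : 'M[K]_n) (N : nat) : 'M[K]_n :=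
  \sum_(0 <= k < N) (k`!%:R^-1 : K) *: X ^+ k.

(* The sum of the exponential series, for the topology of the Frobenius norm
   (the value 0 for a divergent series is a dummy). *)
Definition mexp n (X : 'M[K]_n) : 'M[K]_n :=
  xget 0 [set Y | frobenius (exp_partial X N - Y) @[N --> \oo] --> (0 : R)].

(* The inverse of mexp restricted to hermitian matrices (with a dummy value 0
   outside of the image). *)
Definition mlog n : 'M[K]_n -> 'M[K]_n :=
  'pinv_(fun=> 0) (@selfadjoint n) (@mexp n).

Definition dlog n (A B : 'M[K]_n) : R := frobenius (mlog A - mlog B).

End LogEuclidean.

Arguments selfadjoint R D n : clear implicits.
Arguments posdef R D n : clear implicits.
Arguments dlog R D {n} A B.

Definition Psi1 (R : realType) n (X : 'M[R[i]]_n) : 'M[R]_(n + n) :=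
  let A := map_mx (@complex.Re R) X in
  let B := map_mx (@complex.Im R) X in
  block_mx A B (- B) A.

Definition Psi2 (R : realType) m (X : 'M[quaternion R]_m) : 'M[R[i]]_(m + m) :=
  let Z1 := map_mx (@quat1 R) X in
  let Z2 := map_mx (@quat2 R) X in
  block_mx Z1 Z2 (- map_mx (@Num.conj R[i]) Z2) (map_mx (@Num.conj R[i]) Z1).

Definition tposdefC (R : realType) n : set 'M[R]_(n + n) :=
  @Psi1 R n @` posdef R CC n.

Definition tposdefH (R : realType) m : set 'M[R[i]]_(m + m) :=
  @Psi2 R m @` posdef R HH m.

Arguments tposdefC R n : clear implicits.
Arguments tposdefH R m : clear implicits.

(* Only used on tposdefC, resp. tposdefH. *)
Definition tdlogR (R : realType) n (A B : 'M[R]_(n + n)) : R :=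
  (Num.sqrt 2)^-1 * dlog R RR A B.

Definition tdlogC (R : realType) m (A B : 'M[R[i]]_(m + m)) : R :=
  (Num.sqrt 2)^-1 * dlog R CC A B.

Definition isometry_between (R : realType) (T U : Type)
    (E : set T) (dE : T -> T -> R) (F : set U) (dF : U -> U -> R)
    (f : T -> U) : Prop :=
  set_bij E F f /\ forall x y, E x -> E y -> dF (f x) (f y) = dE x y.

(* Main.v *)
Require Import Defs.
From mathcomp Require Import all_boot all_order all_algebra.
From mathcomp Require Import complex ring.
From mathcomp Require Import all_classical all_reals all_analysis.

(** The maps [Psi1] and [Psi2] are injective morphisms of real star-algebras
which double the real trace. They therefore multiply the Frobenius norm by
[sqrt 2], a factor that the normalization of the distance on the image
removes, and it only remains to see that they commute with the logarithm: the
distance between the images of [A] and [B] is then the norm of the image of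
[log A - log B] ([dlog_emb]).

A star-morphism maps the partial sums of the exponential series of [X] to
those of the image of [X], and as it scales the norm it preserves and reflects
the convergence of this series ([emb_exp_cvg]). So the image of a logarithm of
[A] is a logarithm of the image of [A]. In the other direction one must know
that a self-adjoint logarithm [Y] of [Psi1 A] lies in the image of [Psi1].
This image is the set of fixed points of a star-automorphism [s] of the
target: conjugation by the complex structure [J] for [Psi1], the same combined
with entrywise complex conjugation for [Psi2] ([Psi1_fixedP], [Psi2_fixedP]).
Since [s] fixes [Psi1 A], the matrix [s Y] is again a self-adjoint logarithm
of [Psi1 A], and uniqueness of logarithms gives [s Y = Y] ([mlog_emb]).

Uniqueness of logarithms, i.e. injectivity of the exponential on self-adjoint
matrices, is proved for complex matrices by the spectral theorem
([hermitian_exp_inj]): the unitary matrix that compares two eigenbases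
intertwines the exponentials of the eigenvalues, hence the eigenvalues. The
real and the quaternionic cases follow by embedding into complex matrices
([selfadjoint_exp_inj]). *)

Set Implicit Arguments.
Unset Strict Implicit.
Unset Printing Implicit Defensive.

Import Order.TTheory GRing.Theory Num.Theory.
Import numFieldNormedType.Exports.

Local Open Scope classical_set_scope.
Local Open Scope ring_scope.

(** * Conjugation and real part over the three kinds of scalars *)

Section Components.
Variable R : realType.

Lemma ReD : {morph @complex.Re R : x y / x + y}.
Proof. by move=> [? ?] []. Qed.

Lemma ImD : {morph @complex.Im R : x y / x + y}.
Proof. by move=> [? ?] []. Qed.

End Components.

Section Scalars.
Variables (R : realType) (D : scalars).
Local Notation K := (carrier R D).
Implicit Types x y : K.

Lemma conjDB x y : conjD (x - y) = conjD x - conjD y.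
Proof.
case: D x y => //= [x y|[a b] [c d]]; first exact: rmorphB.
by congr Quaternion; rewrite /= ?rmorphB ?opprD.
Qed.

Lemma conjD0 : conjD (0 : K) = 0.
Proof. by rewrite -[X in conjD X](subrr 0) conjDB subrr. Qed.

Lemma conjDD (x y : K) : conjD (x + y) = conjD x + conjD y.
Proof.
by rewrite -[in LHS](opprK y) -(add0r (- y)) !conjDB conjD0 sub0r opprK.
Qed.

Lemma conjDK : involutive (@conjD R D).
Proof.
case: D => //= [x|[a b]]; first exact: conjCK.
by rewrite /conjq /= conjCK opprK.
Qed.

Lemma conjDM x y : conjD (x * y) = conjD y * conjD x.
Proof.
case: D x y => //= [x y|x y|[a b] [c d]]; first exact: mulrC.
  by rewrite rmorphM mulrC.
by congr Quaternion; rewrite /= ?rmorphB ?rmorphM ?rmorphN /= ?conjCK; ring.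
Qed.

Lemma conjD1 : conjD (1 : K) = 1.
Proof. by rewrite -[LHS]mulr1 -[X in _ * X]conjDK -conjDM mulr1 conjDK. Qed.

Lemma reDD x y : reD (x + y) = reD x + reD y.
Proof. by case: D x y => //= [[a b] [c d]|[[a b] ?] [[c d] ?]]. Qed.

Lemma reD0 : reD (0 : K) = 0.
Proof. by apply: (addIr (reD (0 : K))); rewrite -reDD !add0r. Qed.

(** This weak form of commutativity holds over the quaternions too, and it is
all that the invariance of the real trace under unitary conjugation needs. It
lets the three cases be treated together. *)
Lemma reD_mulC x y : reD (x * y) = reD (y * x).
Proof.
case: D x y => //= [x y|x y|[[a b] [c d]] [[a' b'] [c' d']]] /=.
- exact: mulrC.
- by rewrite mulrC.
- by ring.
Qed.

(** An additive map commutes with the coefficients [1 / k!] of the exponential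
series because these are inverses of integers. *)
Lemma natr_unit k : (k.+1%:R : K) \is a GRing.unit.
Proof.
case: D; rewrite ?unitfE ?pnatr_eq0 //.
have E j : quat1 (j%:R : quaternion R) = j%:R.
  by elim: j => // j IH; rewrite -addn1 !natrD -IH.
apply/eqP => /(congr1 (@quat1 R)); rewrite E => /eqP.
by rewrite pnatr_eq0.
Qed.

End Scalars.

(** * Conjugate transposes and the exponential series *)

Section CtrMx.
Variables (R : realType) (D : scalars).
Local Notation K := (carrier R D).

Lemma ctrmxB m n (A B : 'M[K]_(m, n)) : ctrmx (A - B) = ctrmx A - ctrmx B.
Proof. by apply/matrixP => i j; rewrite !mxE conjDB. Qed.

Lemma ctrmxK m n (A : 'M[K]_(m, n)) : ctrmx (ctrmx A) = A.
Proof. by apply/matrixP => i j; rewrite !mxE conjDK. Qed.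

Lemma ctrmx_mul m n p (A : 'M[K]_(m, n)) (B : 'M[K]_(n, p)) :
  ctrmx (A *m B) = ctrmx B *m ctrmx A.
Proof.
apply/matrixP => i j; rewrite !mxE (big_morph _ (@conjDD R D) (conjD0 R D)).
by apply: eq_bigr => k _; rewrite !mxE conjDM.
Qed.

Lemma reD_mxtrace_mulC m n (A : 'M[K]_(m, n)) (B : 'M[K]_(n, m)) :
  reD (\tr (A *m B)) = reD (\tr (B *m A)).
Proof.
rewrite /mxtrace !(big_morph _ (@reDD R D) (reD0 R D)).
under eq_bigr do rewrite mxE (big_morph _ (@reDD R D) (reD0 R D)).
rewrite exchange_big; apply: eq_bigr => i _.
rewrite mxE (big_morph _ (@reDD R D) (reD0 R D)).
by apply: eq_bigr => j _; exact: reD_mulC.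
Qed.

(** Convergence of the series is kept as a relation, since [mexp] returns a
dummy value on a divergent series. *)
Definition exp_cvg n (X Y : 'M[K]_n) :=
  frobenius (exp_partial X N - Y) @[N --> \oo] --> (0 : R).

End CtrMx.

(** * Trace-scaling embeddings of star-algebras *)

(** What [Psi1], [Psi2], the inclusion of the reals in the complex numbers and
the conjugations by unitary matrices have in common: injective morphisms of
real star-algebras that multiply the real trace by a constant [c]. They
multiply the Frobenius norm by [sqrt c], hence they preserve and reflect
convergence of the exponential series. *)
Record star_emb (R : realType) (D E : scalars) (n m : nat) (c : R)
    (f : 'M[carrier R D]_n -> 'M[carrier R E]_m) : Prop := StarEmb {
  emb_gt0 : 0 < c;
  emb_inj : injective f;
  embB : {morph f : X Y / X - Y};
  embM : {morph f : X Y / X *m Y};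
  emb1 : f 1%:M = 1%:M;
  emb_ctrmx : forall X, f (ctrmx X) = ctrmx (f X);
  emb_trace : forall X, reD (\tr (f X)) = c * reD (\tr X) }.

Section StarEmb.
Variables (R : realType) (D E : scalars) (n m : nat) (c : R).
Variable f : 'M[carrier R D]_n -> 'M[carrier R E]_m.
Hypothesis fE : star_emb c f.

Lemma emb0 : f 0 = 0.
Proof. by rewrite -[X in f X](subrr 0) (embB fE) subrr. Qed.

Lemma embD : {morph f : X Y / X + Y}.
Proof.
move=> X Y; rewrite -[in LHS](opprK Y) -[- Y]add0r.
by rewrite !(embB fE) emb0 sub0r opprK.
Qed.

Lemma emb_exp_partial X N : f (exp_partial X N) = exp_partial (f X) N.
Proof.
have fMn Y k : f (Y *+ k) = f Y *+ k.
  by elim: k => [|k IH]; rewrite ?emb0 // !mulrS embD IH.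
have fX k : f (X ^+ k) = f X ^+ k.
  elim: k => [|k IH]; first exact: emb1 fE.
  rewrite !exprS -IH; exact: embM fE _ _.
rewrite /exp_partial (big_morph _ embD emb0); apply: eq_bigr => k _.
rewrite -fX; have /prednK <- := fact_gt0 k; set j := (_.-1).
have /= uE := natr_unit R E j; have /= uD := natr_unit R D j.
rewrite -[LHS]scale1r -[X in X *: _ = _](mulVr uE) -scalerA; congr (_ *: _).
by rewrite scaler_nat -fMn -scaler_nat scalerA mulrV // scale1r.
Qed.

Lemma emb_frobenius X : frobenius (f X) = Num.sqrt c * frobenius X.
Proof.
rewrite /frobenius -(emb_ctrmx fE) -(embM fE) (emb_trace fE).
by rewrite sqrtrM // ltW // (emb_gt0 fE).
Qed.

Lemma emb_selfadjoint X : selfadjoint R E m (f X) <-> selfadjoint R D n X.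
Proof.
rewrite /selfadjoint /= -(emb_ctrmx fE); split=> [|<- //].
exact: emb_inj fE _ _.
Qed.

(** The maps [f] are homotheties for the Frobenius norm and commute with the
partial sums, so convergence can be tested on either side. All the transfers
between the three kinds of scalars rest on this equivalence. *)
Lemma emb_exp_cvg X Y : exp_cvg (f X) (f Y) <-> exp_cvg X Y.
Proof.
have c0 : Num.sqrt c != 0 by rewrite gt_eqF // sqrtr_gt0 (emb_gt0 fE).
rewrite /exp_cvg.
under eq_fun do rewrite -emb_exp_partial -(embB fE) emb_frobenius.
split=> h; last first.
  by rewrite -(mulr0 (Num.sqrt c)); apply: cvgM h; apply: cvg_cst.
rewrite -(mulr0 (Num.sqrt c)^-1).
under eq_fun do rewrite -[frobenius _](mulKf c0).
by apply: cvgM h; apply: cvg_cst.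
Qed.

End StarEmb.

Lemma emb_comp (R : realType) (D E F : scalars) (n m p : nat) (c d : R)
    (f : 'M[carrier R D]_n -> 'M[carrier R E]_m)
    (g : 'M[carrier R E]_m -> 'M[carrier R F]_p) :
  star_emb c f -> star_emb d g -> star_emb (d * c) (g \o f).
Proof.
move=> fE gE; split=> [||X Y|X Y||X|X] /=.
- by rewrite mulr_gt0 ?(emb_gt0 fE) ?(emb_gt0 gE).
- exact: inj_comp (emb_inj gE) (emb_inj fE).
- by rewrite (embB fE) (embB gE).
- by rewrite (embM fE) (embM gE).
- by rewrite (emb1 fE) (emb1 gE).
- by rewrite (emb_ctrmx fE) (emb_ctrmx gE).
- by rewrite (emb_trace gE) (emb_trace fE) mulrA.
Qed.

Lemma unitary_conj_emb (R : realType) (D : scalars) (n : nat)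
    (U : 'M[carrier R D]_n) : ctrmx U *m U = 1%:M -> U *m ctrmx U = 1%:M ->
  star_emb 1 (fun X => U *m X *m ctrmx U).
Proof.
move=> UU UU'; split=> [||X Y|X Y||X|X]; first exact: ltr01.
- move=> X Y /(congr1 (fun Z => ctrmx U *m Z *m U)).
  by rewrite !mulmxA UU !mul1mx -!mulmxA UU !mulmx1.
- by rewrite mulmxBr mulmxBl.
- by rewrite !mulmxA -(mulmxA _ (ctrmx U) U) UU mulmx1.
- by rewrite mulmx1 UU'.
- by rewrite !ctrmx_mul ctrmxK mulmxA.
- by rewrite reD_mxtrace_mulC mulmxA UU mul1mx mul1r.
Qed.

(** * The exponential series of real matrices *)

Section RealCase.
Variables (R : realType) (n : nat).
Implicit Types X Y Z : 'M[R]_n.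

Lemma frobenius_sum_sqr X :
  @frobenius R RR n X = Num.sqrt (\sum_i \sum_j X i j ^+ 2).
Proof.
rewrite /frobenius /= /mxtrace exchange_big; congr (Num.sqrt _).
by apply: eq_bigr => i _; rewrite mxE; apply: eq_bigr => j _; rewrite !mxE.
Qed.

Lemma entry_le_frobenius X i j : `|X i j| <= @frobenius R RR n X.
Proof.
rewrite frobenius_sum_sqr -sqrtr_sqr; apply: ler_wsqrtr.
rewrite (bigD1 i) //= (bigD1 j) //= -addrA lerDl.
by rewrite addr_ge0 ?sumr_ge0 // => *; rewrite ?sumr_ge0 // => *;
  rewrite sqr_ge0.
Qed.

(** Over the reals the Frobenius topology is that of the entries, which
reduces convergence to real sequences. *)
Lemma exp_cvgP X Y : @exp_cvg R RR n X Y <->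
  forall i j, (@exp_partial R RR n X N) i j @[N --> \oo] --> Y i j.
Proof.
split=> [h i j|h].
  apply/subr_cvg0/norm_cvg0P; apply: squeeze_cvgr h => //; last exact: cvg_cst.
  apply: nearW => N; rewrite normr_ge0 /=.
  by have := entry_le_frobenius (@exp_partial R RR n X N - Y) i j; rewrite !mxE.
have S : \sum_i \sum_j (@exp_partial R RR n X N - Y) i j ^+ 2 @[N --> \oo] -->
    \sum_(i < n) \sum_(j < n) (0 : R) ^+ 2.
  apply: cvg_big => // [|i _]; first exact: add_continuous.
  apply: cvg_big => // [|j _]; first exact: add_continuous.
  under eq_fun do rewrite expr2 !mxE.
  by rewrite expr2; apply: cvgM; apply/subr_cvg0.
(* The sums of squares of the entries tend to [0], hence so does their root.
   *)
rewrite big1 in S; last by move=> i _; rewrite big1 // => j _; rewrite expr0n.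
rewrite /exp_cvg; under eq_fun do rewrite frobenius_sum_sqr.
have := cvg_comp _ _ S (@sqrt_continuous R 0); rewrite sqrtr0; exact.
Qed.

Lemma exp_cvg_diag (x : 'rV[R]_n) :
  @exp_cvg R RR n (diag_mx x) (diag_mx (map_mx (@expR R) x)).
Proof.
have diagX k : diag_mx x ^+ k = diag_mx (map_mx (fun t => t ^+ k) x).
  elim: k => [|k IH].
    by apply/matrixP => i j; rewrite !mxE expr0.
  rewrite exprS IH -[LHS]/(_ *m _) mulmx_diag; congr diag_mx.
  by apply/rowP => i; rewrite !mxE exprS.
apply/exp_cvgP => i j; rewrite !mxE.
have [<-|ij] := eqVneq i j; last first.
  rewrite mulr0n; under eq_fun => N.
    rewrite /exp_partial summxE big1 => [|k _]; last first.
      by rewrite diagX !mxE (negPf ij) mulr0.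
    over.
  exact: cvg_cst.
rewrite mulr1n; under eq_fun => N.
  rewrite /exp_partial summxE.
  under eq_bigr => k _ do rewrite diagX !mxE eqxx mulr1n mulrC.
  over.
exact: is_cvg_series_exp_coeff.
Qed.

End RealCase.

(** * The three embeddings between real, complex and quaternionic matrices *)

Lemma complexify_emb (R : realType) n :
  @star_emb R RR CC n n 1 (map_mx (real_complex R)).
Proof.
split=> [||X Y|X Y||X|X] /=; first exact: ltr01.
- by apply: map_mx_inj; exact: complexI.
- exact: map_mxB.
- exact: map_mxM.
- exact: map_mx1.
- by apply/matrixP => i j; rewrite !mxE; symmetry; exact: conjc_real.
- by rewrite trace_map_mx mul1r.
Qed.

(** The common shape of the values of [Psi1] and [Psi2]: for [Psi1] the
matrices [A1], [B1] are [A], [B]; for [Psi2] they are the entrywise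
conjugates. The right hand side then displays the multiplication rule of the
complex numbers, respectively of the quaternions. *)
Lemma mulmx_skew_block (K : pzRingType) n (A B A' B' A1 B1 A1' B1' : 'M[K]_n) :
  block_mx A B (- B1) A1 *m block_mx A' B' (- B1') A1' =
  block_mx (A *m A' - B *m B1') (A *m B' + B *m A1')
           (- (A1 *m B1' + B1 *m A')) (A1 *m A1' - B1 *m B').
Proof.
rewrite mulmx_block !mulNmx !mulmxN opprD.
by rewrite (addrC (- (A1 *m B1'))) (addrC (- (B1 *m B'))).
Qed.

Section Psi1.
Variables (R : realType) (n : nat).
Implicit Types X Y : 'M[R[i]]_n.
Local Notation Remx := (map_mx (@complex.Re R)).
Local Notation Immx := (map_mx (@complex.Im R)).

Lemma Remx_mul X Y : Remx (X *m Y) = Remx X *m Remx Y - Immx X *m Immx Y.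
Proof.
apply/matrixP => i j; rewrite !mxE (big_morph _ (@ReD R) (erefl _)) -sumrB.
by apply: eq_bigr => k _; rewrite !mxE; case: (X i k) (Y k j) => [? ?] [].
Qed.

Lemma Immx_mul X Y : Immx (X *m Y) = Remx X *m Immx Y + Immx X *m Remx Y.
Proof.
apply/matrixP => i j; rewrite !mxE (big_morph _ (@ImD R) (erefl _)) -big_split.
by apply: eq_bigr => k _; rewrite !mxE; case: (X i k) (Y k j) => [? ?] [].
Qed.

Lemma Psi1_inj : injective (@Psi1 R n).
Proof.
move=> X Y /eq_block_mx [/matrixP re /matrixP im _ _].
apply/matrixP => i j; move: (re i j) (im i j); rewrite !mxE.
by case: (X i j) (Y i j) => [? ?] [? ?] /= -> ->.
Qed.

Lemma Psi1_emb : @star_emb R CC RR n (n + n) 2 (@Psi1 R n).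
Proof.
split=> [||X Y|X Y||X|X] /=; first exact: ltr0n.
- exact: Psi1_inj.
- have ReB : Remx (X - Y) = Remx X - Remx Y.
    by apply/matrixP => i j; rewrite !mxE; case: (X i j) (Y i j) => [? ?] [].
  have ImB : Immx (X - Y) = Immx X - Immx Y.
    by apply/matrixP => i j; rewrite !mxE; case: (X i j) (Y i j) => [? ?] [].
  by rewrite /Psi1 ReB ImB opp_block_mx add_block_mx opprB opprK (addrC (- _)).
- by rewrite /Psi1 mulmx_skew_block Remx_mul Immx_mul.
- rewrite /Psi1.
  have -> : Remx (1%:M : 'M[R[i]]_n) = 1%:M.
    by apply/matrixP => i j; rewrite !mxE; case: eqP; rewrite ?mulr1n ?mulr0n.
  have -> : Immx (1%:M : 'M[R[i]]_n) = 0.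
    by apply/matrixP => i j; rewrite !mxE; case: eqP; rewrite ?mulr1n ?mulr0n.
  by rewrite oppr0 scalar_mx_block.
- rewrite /Psi1 /ctrmx tr_block_mx map_block_mx /=.
  congr block_mx; apply/matrixP => i j; rewrite !mxE /=;
    by case: (X j i) => * //=; rewrite opprK.
- rewrite /Psi1 mxtrace_block mulr_natl mulr2n.
  rewrite /mxtrace (big_morph _ (@ReD R) (erefl _)).
  by congr (_ + _); apply: eq_bigr => i _; rewrite mxE.
Qed.

End Psi1.

Lemma map_mx_conjCK (C : numClosedFieldType) m n (Z : 'M[C]_(m, n)) :
  map_mx Num.conj (map_mx Num.conj Z) = Z.
Proof. by apply/matrixP => i j; rewrite !mxE conjCK. Qed.

Section Psi2.
Variables (R : realType) (m : nat).
Local Notation H := (quaternion R).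
Implicit Types X Y : 'M[H]_m.
Local Notation q1mx := (map_mx (@quat1 R)).
Local Notation q2mx := (map_mx (@quat2 R)).
Local Notation bar := (map_mx (@Num.conj R[i])).

Lemma q1mx_mul X Y : q1mx (X *m Y) = q1mx X *m q1mx Y - q2mx X *m bar (q2mx Y).
Proof.
have qD : {morph @quat1 R : x y / x + y} by [].
apply/matrixP => i j; rewrite !mxE (big_morph _ qD (erefl _)) -sumrB.
by apply: eq_bigr => k _; rewrite !mxE.
Qed.

Lemma q2mx_mul X Y : q2mx (X *m Y) = q1mx X *m q2mx Y + q2mx X *m bar (q1mx Y).
Proof.
have qD : {morph @quat2 R : x y / x + y} by [].
apply/matrixP => i j; rewrite !mxE (big_morph _ qD (erefl _)) -big_split.
by apply: eq_bigr => k _; rewrite !mxE.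
Qed.

Lemma Psi2_inj : injective (@Psi2 R m).
Proof.
move=> X Y /eq_block_mx [/matrixP q1 /matrixP q2 _ _].
apply/matrixP => i j; move: (q1 i j) (q2 i j); rewrite !mxE.
by case: (X i j) (Y i j) => [? ?] [? ?] /= -> ->.
Qed.

Lemma Psi2_emb : @star_emb R HH CC m (m + m) 2 (@Psi2 R m).
Proof.
split=> [||X Y|X Y||X|X] /=; first exact: ltr0n.
- exact: Psi2_inj.
- have q1B : q1mx (X - Y) = q1mx X - q1mx Y.
    by apply/matrixP => i j; rewrite !mxE.
  have q2B : q2mx (X - Y) = q2mx X - q2mx Y.
    by apply/matrixP => i j; rewrite !mxE.
  rewrite /Psi2 q1B q2B !map_mxB opp_block_mx add_block_mx.
  by rewrite opprB opprK (addrC (- _)).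
- rewrite /Psi2 mulmx_skew_block q1mx_mul q2mx_mul map_mxB map_mxD !map_mxM.
  by rewrite !map_mx_conjCK.
- rewrite /Psi2.
  have -> : q1mx (1%:M : 'M[H]_m) = 1%:M.
    by apply/matrixP => i j; rewrite !mxE; case: eqP; rewrite ?mulr1n ?mulr0n.
  have -> : q2mx (1%:M : 'M[H]_m) = 0.
    by apply/matrixP => i j; rewrite !mxE; case: eqP; rewrite ?mulr1n ?mulr0n.
  by rewrite map_mx0 map_mx1 oppr0 scalar_mx_block.
- rewrite /Psi2 /ctrmx tr_block_mx map_block_mx /=.
  congr block_mx; apply/matrixP => i j; rewrite !mxE //=;
    by rewrite ?rmorphN ?opprK /= ?conjCK.
- have qD : {morph (fun q : H => complex.Re (quat1 q)) : x y / x + y}.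
    by move=> [[? ?] ?] [[? ?] ?].
  rewrite /Psi2 mxtrace_block (@ReD R) mulr_natl mulr2n.
  rewrite /mxtrace (big_morph _ qD (erefl _)) !(big_morph _ (@ReD R) (erefl _)).
  congr (_ + _); apply: eq_bigr => i _; rewrite !mxE //.
  by case: (X i i) => [[? ?] ?].
Qed.

End Psi2.

(** * Injectivity of the exponential on self-adjoint matrices *)

(** Entrywise for real matrices; [Psi1] reduces the complex case to the real
one, and [Psi2] reduces the quaternionic case to the complex one. *)
Lemma exp_cvg_unique (R : realType) (D : scalars) n
    (X Y Z : 'M[carrier R D]_n) :
  exp_cvg X Y -> exp_cvg X Z -> Y = Z.
Proof.
have uniqR k (A B C : 'M[R]_k) :
    @exp_cvg R RR k A B -> @exp_cvg R RR k A C -> B = C.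
  move=> /exp_cvgP AB /exp_cvgP AC; apply/matrixP => i j.
  by apply: cvg_unique (AB i j) (AC i j); exact: Rhausdorff.
have uniqC k (A B C : 'M[R[i]]_k) :
    @exp_cvg R CC k A B -> @exp_cvg R CC k A C -> B = C.
  move=> /(emb_exp_cvg (Psi1_emb R k)) AB /(emb_exp_cvg (Psi1_emb R k)) AC.
  exact: Psi1_inj (uniqR _ _ _ _ AB AC).
case: D X Y Z => [|| X Y Z]; [exact: uniqR|exact: uniqC|].
move=> /(emb_exp_cvg (Psi2_emb R n)) XY /(emb_exp_cvg (Psi2_emb R n)) XZ.
exact: Psi2_inj (uniqC _ _ _ _ XY XZ).
Qed.

(** The equation says that [W i j] vanishes unless [b i = a j], and replacing
the diagonal entries by others with at least the same coincidences preserves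
this. It plays the role of a functional calculus. *)
Lemma intertwine_diag (K : idomainType) n (W : 'M[K]_n) (a b a' b' : 'rV[K]_n) :
  (forall i j, b 0 i = a 0 j -> b' 0 i = a' 0 j) ->
  diag_mx b *m W = W *m diag_mx a -> diag_mx b' *m W = W *m diag_mx a'.
Proof.
move=> ab /matrixP bWa; apply/matrixP => i j; move: (bWa i j).
rewrite !mul_diag_mx !mul_mx_diag !mxE.
have [->|W0] := eqVneq (W i j) 0; first by rewrite !mulr0 !mul0r.
by rewrite mulrC => /(mulfI W0) /ab ->; rewrite mulrC.
Qed.

Lemma hermitian_spectral (C : numClosedFieldType) n (X : 'M[C]_n) :
  X = map_mx Num.conj X^T ->
  exists (P : 'M[C]_n) (d : 'rV[C]_n),
    [/\ P *m map_mx Num.conj P^T = 1%:M, forall i, d 0 i \is Num.real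
      & X = map_mx Num.conj P^T *m diag_mx d *m P].
Proof.
move=> sX; have hX : X \is hermsymmx.
  by apply/is_hermitianmxP; rewrite expr0 scale1r {1}sX.
have Pu := spectral_unitarymx X.
exists (spectralmx X), (spectral_diag X); split.
- exact/unitarymxP.
- by move=> i; have /mxOverP := hermitian_spectral_diag_real hX.
- by have /orthomx_spectralP := hermitian_normalmx hX; rewrite invmx_unitary.
Qed.

Section Hermitian.
Variables (R : realType) (n : nat).
Local Notation ctr := (@ctrmx R CC n n).
Local Notation diagC x := (map_mx (real_complex R) (diag_mx x)).

Lemma hermitian_diagonalizable (X : 'M[R[i]]_n) : selfadjoint R CC n X ->
  exists (U : 'M[R[i]]_n) (x : 'rV[R]_n),
    [/\ ctr U *m U = 1%:M, U *m ctr U = 1%:M & X = U *m diagC x *m ctr U].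
Proof.
move=> /hermitian_spectral [P [d [PP d_real XE]]].
have ctrK : ctr (ctr P) = P := @ctrmxK R CC n n P.
have dE : diagC (map_mx (@complex.Re R) d) = diag_mx d.
  rewrite map_diag_mx -map_mx_comp; congr diag_mx.
  by apply/rowP => i; rewrite mxE /= RRe_real.
exists (ctr P), (map_mx (@complex.Re R) d).
rewrite ctrK; split; [exact: PP|exact: mulmx1C PP|].
by rewrite dE; exact: XE.
Qed.

(** Diagonalize [X = U x U^*] and [Y = V y V^*]. If the exponentials agree,
then [W = V^* U] intertwines the diagonal matrices [e^x] and [e^y]; the real
exponential being injective, [W] intertwines [x] and [y] as well, which means
that [X = Y]. *)
Lemma hermitian_exp_inj (X Y A : 'M[R[i]]_n) :
  selfadjoint R CC n X -> selfadjoint R CC n Y ->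
  @exp_cvg R CC n X A -> @exp_cvg R CC n Y A -> X = Y.
Proof.
move=> /hermitian_diagonalizable [U [x [UU UU' ->]]].
move=> /hermitian_diagonalizable [V [y [VV VV' ->]]] expX expY.
(* The exponential of a matrix diagonalized by [W] is computed on the
   diagonal. *)
have expE W (z : 'rV[R]_n) : ctr W *m W = 1%:M -> W *m ctr W = 1%:M ->
    @exp_cvg R CC n (W *m diagC z *m ctr W)
                    (W *m diagC (map_mx (@expR R) z) *m ctr W).
  move=> WW WW'; apply/(emb_exp_cvg (@unitary_conj_emb R CC n W WW WW')).
  exact/(emb_exp_cvg (complexify_emb R n))/exp_cvg_diag.
have := exp_cvg_unique expX (expE _ _ UU UU').
rewrite (exp_cvg_unique expY (expE _ _ VV VV')) => eqA.
set W := ctr V *m U.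
have WE : diagC (map_mx (@expR R) y) *m W = W *m diagC (map_mx (@expR R) x).
  have := congr1 (fun Z => ctr V *m Z *m U) eqA.
  by rewrite /= !mulmxA VV mul1mx -!mulmxA UU mulmx1 !mulmxA.
have WD : diagC y *m W = W *m diagC x.
  (* Coincidences [e^(y_i) = e^(x_j)] are coincidences [y_i = x_j]. *)
  move: WE; rewrite !map_diag_mx; apply: intertwine_diag => i j.
  by rewrite !mxE => /complexI /expR_inj ->.
have UE : U = V *m W by rewrite mulmxA VV' mul1mx.
have WU : W *m ctr U = ctr V by rewrite -mulmxA UU' mulmx1.
by rewrite {1}UE -(mulmxA V) -WD mulmxA -(mulmxA _ W) WU.
Qed.

End Hermitian.

(** Real and quaternionic self-adjoint matrices are turned into complex
hermitian ones by the inclusion of the reals and by [Psi2]. *)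
Lemma selfadjoint_exp_inj (R : realType) (D : scalars) n
    (X Y A : 'M[carrier R D]_n) :
  selfadjoint R D n X -> selfadjoint R D n Y ->
  exp_cvg X A -> exp_cvg Y A -> X = Y.
Proof.
have transfer (m : nat) c (f : 'M[carrier R D]_n -> 'M[carrier R CC]_m) :
    star_emb c f -> selfadjoint R D n X -> selfadjoint R D n Y ->
    exp_cvg X A -> exp_cvg Y A -> X = Y.
  move=> fE /(emb_selfadjoint fE) sX /(emb_selfadjoint fE) sY.
  move=> /(emb_exp_cvg fE) eX /(emb_exp_cvg fE) eY.
  exact: emb_inj fE _ _ (hermitian_exp_inj sX sY eX eY).
case: D X Y A transfer => X Y A transfer.
- exact: transfer (complexify_emb R n).
- exact: hermitian_exp_inj.
- exact: transfer (Psi2_emb R n).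
Qed.

(** * The logarithm and its compatibility with embeddings *)

Section Log.
Variables (R : realType) (D : scalars) (n : nat).
Implicit Types X A : 'M[carrier R D]_n.

(** The dummy value of [mexp] is [0], so a nonzero value is a genuine sum of
the series. *)
Lemma mexp_eq X A : A != 0 -> mexp X = A <-> exp_cvg X A.
Proof.
move=> A0; split=> [|XA]; last first.
  by apply: (exp_cvg_unique _ XA); exact: (xgetPex 0 (ex_intro _ A XA)).
rewrite /mexp; case: xgetP => [Y -> XY <- //|_ E].
by rewrite -E eqxx in A0.
Qed.

Lemma mlog_eq X A : A != 0 -> selfadjoint R D n X -> exp_cvg X A -> mlog A = X.
Proof.
move=> A0 sX XA.
have imA : ((@mexp R D n) @` selfadjoint R D n) A.
  by exists X => //; apply/mexp_eq.
rewrite /mlog /pinv_ splitV /= oinv_surj; case: pselect => // im_A.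
case: cid2 => Y sY YA /=.
exact: selfadjoint_exp_inj sY sX ((mexp_eq Y A0).1 YA) XA.
Qed.

(** The case to be matched on both sides of an embedding when [A] has no
self-adjoint logarithm. *)
Lemma mlog_dflt A : A != 0 ->
  ~ (exists2 X, selfadjoint R D n X & exp_cvg X A) -> mlog A = 0.
Proof.
move=> A0 noX; rewrite /mlog /pinv_ splitV /= oinv_surj.
case: pselect => // im_A; case: noX; have [X sX XA] := im_A.
by exists X => //; exact/mexp_eq.
Qed.

End Log.

(** This separates the positive definite matrices from the dummy value of
[mexp]; a test vector exists as soon as the size is positive. *)
Lemma posdef_neq0 (R : realType) (D : scalars) n (A : 'M[carrier R D]_n) :
  (0 < n)%N -> posdef R D n A -> A != 0.
Proof.
case: n A => // n A _ [_ /(_ (const_mx 1))] pA; apply/eqP => A0.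
have /pA : const_mx 1 != 0 :> 'cV[carrier R D]_n.+1.
  apply/eqP => /matrixP /(_ ord0 ord0) /eqP; rewrite !mxE.
  by case: D {A pA A0} => /=; rewrite oner_eq0.
by rewrite A0 mulmx0 mul0mx mxE reD0 ltxx.
Qed.

Section LogEmb.
Variables (R : realType) (D E : scalars) (n m : nat) (c : R).
Variable f : 'M[carrier R D]_n -> 'M[carrier R E]_m.
Variable s : 'M[carrier R E]_m -> 'M[carrier R E]_m.
Hypothesis fE : star_emb c f.
Hypothesis sE : star_emb 1 s.
Hypothesis fix_s : forall Y, s Y = Y <-> exists X, Y = f X.

(** If [X] is a logarithm of [A], then [f X] is one of [f A]. Conversely, let
[Y] be a self-adjoint logarithm of [f A]. As [s] fixes [f A], the matrix [s Y]
is another one, so [s Y = Y] by injectivity of the exponential, and [Y = f X]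
for some [X], which is then a logarithm of [A]. Hence [A] and [f A] have
logarithms simultaneously, and [mlog] commutes with [f] in every case, the two
dummy values included. *)
Lemma mlog_emb A : A != 0 -> mlog (f A) = f (mlog A).
Proof.
move=> A0; have fA0 : f A != 0.
  by apply: contra A0 => /eqP fA; apply/eqP/(emb_inj fE); rewrite fA (emb0 fE).
have [[X sX XA]|noX] :=
  pselect (exists2 X, selfadjoint R D n X & exp_cvg X A).
  rewrite (mlog_eq A0 sX XA) (mlog_eq (X := f X)) //.
    exact/(emb_selfadjoint fE).
  exact/(emb_exp_cvg fE).
rewrite (mlog_dflt A0 noX) (emb0 fE) mlog_dflt // => -[Y sY YA].
have sfA : s (f A) = f A by apply/fix_s; exists A.
(* [s] preserves the series and fixes its sum [f A]. *)
have sYA : exp_cvg (s Y) (f A) by rewrite -sfA; exact/(emb_exp_cvg sE).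
have /fix_s [X YX] : s Y = Y.
  exact: selfadjoint_exp_inj ((emb_selfadjoint sE Y).2 sY) sY sYA YA.
by apply: noX; exists X; [apply/(emb_selfadjoint fE)|apply/(emb_exp_cvg fE)];
  rewrite -YX.
Qed.

Lemma dlog_emb A B : A != 0 -> B != 0 ->
  dlog R E (f A) (f B) = Num.sqrt c * dlog R D A B.
Proof.
by move=> A0 B0; rewrite /dlog !mlog_emb // -(embB fE) (emb_frobenius fE).
Qed.

End LogEmb.

(** * The images of the embeddings as sets of fixed points *)

Section Symmetry.
Variables (R : realType) (D : scalars) (n : nat).
Local Notation K := (carrier R D).

(** This is [J], the value of [Psi1] at the scalar matrix [i]. A real matrix
is complex linear, i.e. a value of [Psi1], when it commutes with [J]. *)
Definition skewJ : 'M[K]_(n + n) := block_mx 0 1%:M (- 1%:M) 0.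

Lemma ctrmx_skewJ : ctrmx skewJ = block_mx 0 (- 1%:M) 1%:M 0.
Proof.
have ctr0 : ctrmx (0 : 'M[K]_n) = 0.
  by apply/matrixP => i j; rewrite !mxE conjD0.
have ctr1 : ctrmx (1%:M : 'M[K]_n) = 1%:M.
  apply/matrixP => i j; rewrite !mxE eq_sym.
  by case: (i == j); rewrite ?mulr1n ?mulr0n ?conjD1 ?conjD0.
rewrite /skewJ /ctrmx tr_block_mx map_block_mx -!/(ctrmx _).
by rewrite -[- 1%:M]sub0r ctrmxB ctr0 ctr1 sub0r.
Qed.

Lemma skewJ_conj (A B C E : 'M[K]_n) :
  skewJ *m block_mx A B C E *m ctrmx skewJ = block_mx E (- C) (- B) A.
Proof.
rewrite ctrmx_skewJ /skewJ !mulmx_block.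
rewrite !mul0mx !mul1mx !mulNmx !mulmx0 !mulmxN !mulmx1 !mul1mx.
by rewrite !addr0 !add0r opprK.
Qed.

Lemma skewJ_emb : star_emb 1 (fun Y => skewJ *m Y *m ctrmx skewJ).
Proof.
apply: unitary_conj_emb; rewrite ctrmx_skewJ /skewJ mulmx_block
  !mul0mx !mulmx0 !mulNmx !mulmxN !mulmx1 ?opprK !addr0 !add0r ?oppr0;
  by rewrite -scalar_mx_block.
Qed.

End Symmetry.

Lemma Psi1_fixedP (R : realType) n (Y : 'M[R]_(n + n)) :
  skewJ R RR n *m Y *m ctrmx (skewJ R RR n) = Y <-> exists X, Y = Psi1 X.
Proof.
split=> [|[X ->]]; last by rewrite /Psi1 skewJ_conj opprK.
rewrite -{1 2}[Y]submxK skewJ_conj => /eq_block_mx [_ _ eB eA].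
pose X := map2_mx (@Complex R) (ulsubmx Y) (ursubmx Y).
have reE : map_mx (@complex.Re R) X = ulsubmx Y.
  by apply/matrixP => i j; rewrite !mxE.
have imE : map_mx (@complex.Im R) X = ursubmx Y.
  by apply/matrixP => i j; rewrite !mxE.
by exists X; rewrite /Psi1 reE imE -[LHS]submxK -eB -eA.
Qed.

(** Conjugation by the antilinear map [v |-> J (conj v)]. When the
quaternionic vector [z1 + z2 j] is identified with the complex vector of
blocks [z1] and [- conj z2], which is how the values of [Psi2] act, this map
is the right multiplication by [j]. So a complex matrix commutes with it when
it is quaternionic linear, i.e. a value of [Psi2]. *)
Definition Jbar (R : realType) m (Y : 'M[R[i]]_(m + m)) : 'M[R[i]]_(m + m) :=
  skewJ R CC m *m map_mx (@Num.conj R[i]) Y *m @ctrmx R CC _ _ (skewJ R CC m).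

Lemma entry_conj_emb (R : realType) n :
  @star_emb R CC CC n n 1 (map_mx (@Num.conj R[i])).
Proof.
split=> [||X Y|X Y||X|X] /=; first exact: ltr01.
- by apply: map_mx_inj; exact: (can_inj (@conjCK _)).
- exact: map_mxB.
- exact: map_mxM.
- exact: map_mx1.
- by apply/matrixP => i j; rewrite !mxE.
- by rewrite trace_map_mx mul1r; case: (\tr X).
Qed.

Lemma Jbar_emb (R : realType) m :
  @star_emb R CC CC (m + m) (m + m) 1 (@Jbar R m).
Proof.
have := emb_comp (entry_conj_emb R (m + m)) (skewJ_emb R CC m).
by rewrite mulr1.
Qed.

Lemma Psi2_fixedP (R : realType) m (Y : 'M[R[i]]_(m + m)) :
  Jbar Y = Y <-> exists X, Y = Psi2 X.
Proof.
split=> [|[X ->]]; last first.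
  rewrite /Jbar /Psi2 map_block_mx skewJ_conj map_mxN.
  by rewrite !map_mx_conjCK opprK.
rewrite -{1 2}[Y]submxK /Jbar map_block_mx skewJ_conj.
move=> /eq_block_mx [_ _ eB eA].
pose X := map2_mx (@Quaternion R) (ulsubmx Y) (ursubmx Y).
have q1E : map_mx (@quat1 R) X = ulsubmx Y.
  by apply/matrixP => i j; rewrite !mxE.
have q2E : map_mx (@quat2 R) X = ursubmx Y.
  by apply/matrixP => i j; rewrite !mxE.
by exists X; rewrite /Psi2 q1E q2E -[LHS]submxK -eB -eA.
Qed.

(** * The isometries *)

Theorem proposition4p5 (R : realType) (n m : nat)
    (hn : (1 <= n)%N) (hm : (1 <= m)%N) :
  isometry_between (posdef R CC n) (dlog R CC)
                   (tposdefC R n) (@tdlogR R n) (@Psi1 R n) /\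
  isometry_between (posdef R HH m) (dlog R HH)
                   (tposdefH R m) (@tdlogC R m) (@Psi2 R m) /\
  (forall A B : 'M[R[i]]_n, posdef R CC n A -> posdef R CC n B ->
     tdlogR (Psi1 A) (Psi1 B) = dlog R CC A B) /\
  (forall C D : 'M[quaternion R]_m, posdef R HH m C -> posdef R HH m D ->
     tdlogC (Psi2 C) (Psi2 D) = dlog R HH C D).
Proof.
have sqrt2_neq0 : Num.sqrt 2 != 0 :> R by rewrite gt_eqF // sqrtr_gt0 ltr0n.
have isoC A B : posdef R CC n A -> posdef R CC n B ->
    tdlogR (Psi1 A) (Psi1 B) = dlog R CC A B.
  move=> /(posdef_neq0 hn) A0 /(posdef_neq0 hn) B0; rewrite /tdlogR.
  rewrite (dlog_emb (Psi1_emb R n) (skewJ_emb R RR n) (@Psi1_fixedP R n) A0 B0).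
  by rewrite mulKf.
have isoH C D : posdef R HH m C -> posdef R HH m D ->
    tdlogC (Psi2 C) (Psi2 D) = dlog R HH C D.
  move=> /(posdef_neq0 hm) C0 /(posdef_neq0 hm) D0; rewrite /tdlogC.
  rewrite (dlog_emb (Psi2_emb R m) (Jbar_emb R m) (@Psi2_fixedP R m) C0 D0).
  by rewrite mulKf.
split; [|split; [|split; [exact: isoC|exact: isoH]]]; split=> //; split.
- by move=> A PA; exists A.
- by move=> A B _ _; exact: Psi1_inj.
- exact: subset_refl.
- by move=> A PA; exists A.
- by move=> A B _ _; exact: Psi2_inj.
- exact: subset_refl.
Qed.
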